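(* Let $\mathfrak{A}[\mathbb{R}^{2}]$ be the Weyl algebra over $\mathbb{R}^{2}$, with Weyl generators $W(a,b)$, $a,b\in\mathbb{R}$. For each pair of real numbers $\lambda,\mu$, there is a unique state $\omega$ of the spatial tensor product $\mathfrak{A}[\mathbb{R}^{2}]\otimes\mathfrak{A}[\mathbb{R}^{2}]$ such that $$\omega\bigl(W(a,0)\otimes W(-a,0)\bigr)=e^{ia\lambda},\qquad \omega\bigl(W(0,b)\otimes W(0,b)\bigr)=e^{ib\mu},$$ for all $a,b\in\mathbb{R}$. Moreover, $\omega$ is pure.
   Context: The Weyl algebra $\mathfrak{A}[\mathbb{R}^{2}]$ is the $C^{*}$-algebra generated by unitary operators $W(\mathbf{a})$, $\mathbf{a}\in\mathbb{R}^{2}$, satisfying the Weyl relations $W(\mathbf{a})W(\mathbf{b})=\exp\{i\sigma(\mathbf{a},\mathbf{b})\}\,W(\mathbf{a}+\mathbf{b})$, where $\sigma((a,b),(a',b'))=\tfrac12(ab'-ba')$. (This $C^{*}$-algebra is simple, and it is determined up to isomorphism by these relations.) The tensor product $\otimes$ of $C^{*}$-algebras is the spatial (minimal) one. A state of a $C^{*}$-algebra is a positive, normalized linear functional. *)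

(* Defs.v *)
(* MathComp / MathComp-Analysis; the complex numbers are R[i] for R : realType. *)
From HB Require Import structures.
From mathcomp Require Import all_boot all_order all_algebra.
From mathcomp Require Import all_classical all_reals all_analysis.
From mathcomp Require Import complex.

Set Implicit Arguments.
Unset Strict Implicit.
Unset Printing Implicit Defensive.

Import Order.TTheory GRing.Theory Num.Theory.
Import numFieldNormedType.Exports.

Local Open Scope classical_set_scope.
Local Open Scope complex_scope.
Local Open Scope ring_scope.

(* Unital C*-algebras, with the R[i]-valued norm and the topology of the
   library's complete normed modules.  The library has no common substructure
   of rings and normed modules below numDomainType, so the product is a field
   of the mixin, and the algType structure is recovered by instances below. *)
HB.mixin Record isCStarAlgebra (R : realType) A
    of CompleteNormedModule R[i] A := {
  cstar_mul : A -> A -> A ;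
  cstar_one : A ;
  star : A -> A ;
  cstar_mulA : associative cstar_mul ;
  cstar_mul1l : left_id cstar_one cstar_mul ;
  cstar_mul1r : right_id cstar_one cstar_mul ;
  cstar_mulDl : left_distributive cstar_mul +%R ;
  cstar_mulDr : right_distributive cstar_mul +%R ;
  cstar_one_neq0 : cstar_one != 0 ;
  cstar_scaleAl : forall (c : R[i]) (x y : A),
    c *: cstar_mul x y = cstar_mul (c *: x) y ;
  cstar_scaleAr : forall (c : R[i]) (x y : A),
    c *: cstar_mul x y = cstar_mul x (c *: y) ;
  star_antilinear : forall (c : R[i]) (x y : A),
    star (c *: x + y) = Num.conj c *: star x + star y ;
  star_mul : forall x y : A,
    star (cstar_mul x y) = cstar_mul (star y) (star x) ;
  starK : involutive star ;
  cstar_norm_mul : forall x y : A, `|cstar_mul x y| <= `|x| * `|y| ;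
  cstar_norm_star : forall x : A, `|cstar_mul (star x) x| = `|x| ^+ 2
}.

#[short(type="cstarAlgType")]
HB.structure Definition CStarAlgebra (R : realType) :=
  {A of CompleteNormedModule R[i] A & isCStarAlgebra R A}.

#[non_forgetful_inheritance]
HB.instance Definition _ (R : realType) (A : cstarAlgType R) :=
  GRing.Zmodule_isNzRing.Build (CStarAlgebra.sort A)
    (@cstar_mulA R A) (@cstar_mul1l R A) (@cstar_mul1r R A)
    (@cstar_mulDl R A) (@cstar_mulDr R A) (@cstar_one_neq0 R A).

#[non_forgetful_inheritance]
HB.instance Definition _ (R : realType) (A : cstarAlgType R) :=
  GRing.Lmodule_isLalgebra.Build R[i] (CStarAlgebra.sort A)
    (@cstar_scaleAl R A).

#[non_forgetful_inheritance]
HB.instance Definition _ (R : realType) (A : cstarAlgType R) :=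
  GRing.Lalgebra_isAlgebra.Build R[i] (CStarAlgebra.sort A)
    (@cstar_scaleAr R A).

(* Complex Hilbert spaces; the inner product is linear in its first argument. *)
HB.mixin Record isHilbert (R : realType) H
    of CompleteNormedModule R[i] H := {
  inner : {dot H for (@Num.conj R[i])} ;
  inner_norm : forall x : H, `|x| ^+ 2 = inner x x
}.

#[short(type="hilbertType")]
HB.structure Definition Hilbert (R : realType) :=
  {H of CompleteNormedModule R[i] H & isHilbert R H}.

Definition tensor_sums (K : nzRingType) (U V Z : lmodType K)
    (t : U -> V -> Z) : set Z :=
  [set z | exists (n : nat) (u : 'I_n -> U) (v : 'I_n -> V),
     z = \sum_(i < n) t (u i) (v i)].

Definition is_hilbert_tensor (R : realType) (H1 H2 K : hilbertType R)
    (t : {bilinear H1 -> H2 -> K}) : Prop :=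
  (forall x x' y y', inner (t x y) (t x' y') = inner x x' * inner y y') /\
  closure (tensor_sums t) = setT.

Record is_representation (R : realType) (A : cstarAlgType R)
    (H : hilbertType R) (p : A -> {linear H -> H}) : Prop := {
  rep_bounded : forall a, continuous (p a) ;
  rep_linear : forall (c : R[i]) (a b : A) (x : H),
    p (c *: a + b) x = c *: p a x + p b x ;
  rep1 : forall x : H, p 1 x = x ;
  repM : forall (a b : A) (x : H), p (a * b) x = p a (p b x) ;
  rep_star : forall (a : A) (x y : H),
    inner (p a x) y = inner x (p (star a) y)
}.

Definition is_faithful_representation (R : realType) (A : cstarAlgType R)
    (H : hilbertType R) (p : A -> {linear H -> H}) : Prop :=
  is_representation p /\ (forall a, (forall x : H, p a x = 0) -> a = 0).

(* T, with (a, b) |-> t a b, is (a copy of) the norm closure of the algebraic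
   tensor product p1(A) (x) p2(B) inside the bounded operators on the Hilbert
   tensor product of faithful representation spaces of A and B; a faithful
   representation P of T is isometric, so it carries the spatial norm. *)
Definition is_spatial_tensor (R : realType) (A B T : cstarAlgType R)
    (t : {bilinear A -> B -> T}) : Prop :=
  closure (tensor_sums t) = setT /\
  exists (H1 H2 K : hilbertType R) (h : {bilinear H1 -> H2 -> K})
         (p1 : A -> {linear H1 -> H1}) (p2 : B -> {linear H2 -> H2})
         (P : T -> {linear K -> K}),
    [/\ is_hilbert_tensor h,
        is_faithful_representation p1,
        is_faithful_representation p2,
        is_faithful_representation P &
        forall a b x y, P (t a b) (h x y) = h (p1 a x) (p2 b y)].

Record is_cstar_subalgebra (R : realType) (A : cstarAlgType R)
    (B : set A) : Prop := {
  subalg_closed_lin : forall (c : R[i]) (x y : A),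
    B x -> B y -> B (c *: x + y) ;
  subalg_closedM : forall x y : A, B x -> B y -> B (x * y) ;
  subalg_closed_star : forall x : A, B x -> B (star x) ;
  subalg_closed_top : closed B
}.

Definition cstar_generated_by (R : realType) (A : cstarAlgType R)
    (S : set A) : Prop :=
  forall B : set A, is_cstar_subalgebra B -> S `<=` B -> B = setT.

Definition cis (R : realType) (t : R) : R[i] := cos t +i* sin t.

Definition symplectic (R : realType) (u v : R * R) : R :=
  2^-1 * (u.1 * v.2 - u.2 * v.1).

(* These properties determine the pair (A, W) up to isomorphism. *)
Record is_weyl_algebra (R : realType) (A : cstarAlgType R)
    (W : R * R -> A) : Prop := {
  weyl_unitaryl : forall u, star (W u) * W u = 1 ;
  weyl_unitaryr : forall u, W u * star (W u) = 1 ;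
  weyl_relation : forall u v,
    W u * W v = cis (symplectic u v) *: W (u + v) ;
  weyl_generated : cstar_generated_by (range W)
}.

Record is_state (R : realType) (A : cstarAlgType R)
    (w : A -> R[i]) : Prop := {
  state_linear : scalar w ;
  state_positive : forall x : A, 0 <= w (star x * x) ;
  state_normalized : w 1 = 1
}.

Definition is_pure_state (R : realType) (A : cstarAlgType R)
    (w : A -> R[i]) : Prop :=
  is_state w /\
  forall (w1 w2 : A -> R[i]) (s : R),
    is_state w1 -> is_state w2 -> 0 < s < 1 ->
    (forall x, w x = s%:C * w1 x + (1 - s)%:C * w2 x) ->
    w1 = w /\ w2 = w.

(* Main.v *)
(* Write V(u, v) = W(u) (x) W(v).  The unitaries V((a, b), (-a, b)) form a
   commutative group, and a state w with |w(U)| = 1 at a unitary U is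
   multiplicative there: w(xU) = w(x) w(U).  So the two conditions fix w on this
   group; every other V(u, v) anticommutes with a member of the group, whence
   w(V(u, v)) = 0.  As the V(u, v) span a dense subspace, w is unique, and the
   components of a convex decomposition of w satisfy the same conditions, so w
   is pure.

   For existence, twist the group by the prescribed phases, so that the values
   to be realised are all 1.  Averaging a vector state over Weyl translations
   gives in the limit a state tau that vanishes on every non-trivial member of
   the group.  Compressing tau by products of segments 1 + U + ... + U^(N-1)
   moves the values at finitely many U close to 1 (amenability of the group),
   and weak-* compactness of the state space provides the exact state.

   No spectral theory is needed: a small self-adjoint h is the real part of the
   unitary h + i sqrt(1 - h^2), where the square root is obtained by iteration,
   and this makes states and *-homomorphisms bounded. *)
Require Import Defs.
From HB Require Import structures.
From mathcomp Require Import all_boot all_order all_algebra.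
From mathcomp Require Import all_classical all_reals all_analysis.
From mathcomp Require Import complex ring.


Set Implicit Arguments.
Unset Strict Implicit.
Unset Printing Implicit Defensive.

Import Order.TTheory GRing.Theory Num.Theory.
Import numFieldNormedType.Exports.

Local Open Scope classical_set_scope.
Local Open Scope complex_scope.
Local Open Scope ring_scope.


(** * Approximation, closedness and convergence in normed spaces over [R[i]] *)

Section BanachLemmas.
Variable R : realType.
Local Notation C := R[i].

(** The order of [R[i]] compares only numbers with equal imaginary parts, so a positive tolerance is
    real. *)
Lemma complex_gt0_real (e : C) : 0 < e -> exists2 r : R, 0 < r & e = r%:C.
Proof.
move=> e0; exists (complex.Re e); last by rewrite RRe_real ?gtr0_real.
by move: e0; rewrite ltcE => /andP[].
Qed.

Lemma complex_expn_half_lt (e : C) : 0 < e -> exists n : nat, 2^-1 ^+ n < e.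
Proof.
move=> /complex_gt0_real[r r0 ->].
have [n nr] : exists n : nat, r^-1 < n%:R.
  by exists (Num.bound r^-1); apply: archi_boundP; rewrite invr_ge0 ltW.
exists n; have -> : 2^-1 ^+ n = (2^-1 ^+ n : R)%:C.
  by rewrite rmorphXn /= fmorphV rmorph_nat.
rewrite ltcR exprVn -(invrK r) ltf_pV2 ?posrE ?invr_gt0 ?exprn_gt0//.
by apply: (lt_trans nr); rewrite -natrX ltr_nat ltn_expl.
Qed.

Lemma closureP_norm (V : normedModType C) (S : set V) (x : V) :
  closure S x <-> forall e : C, 0 < e -> exists2 z, S z & `|x - z| < e.
Proof.
split=> [Sx e e0|H B /nbhs_ballP[e e0 eB]].
  by have [z [Sz]] := Sx _ (nbhsx_ballx x e e0); rewrite -ball_normE; exists z.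
by have [z Sz xz] := H e e0; exists z; split => //; apply: eB; rewrite -ball_normE.
Qed.

Lemma closed_norm (V : normedModType C) (S : set V) :
  (forall x, (forall e : C, 0 < e -> exists2 z, S z & `|x - z| < e) -> S x) ->
  closed S.
Proof. by move=> H x /closureP_norm /H. Qed.

Lemma norm_lt_all_eq0 (V : normedModType C) (x : V) :
  (forall e : C, 0 < e -> `|x| < e) -> x = 0.
Proof.
move=> H; apply/eqP; rewrite -normr_eq0; apply/negP => /negP x0.
by have := H `|x|; rewrite lt_def x0 normr_ge0 ltxx => /(_ isT).
Qed.

(** Stated for additive maps in order to cover [star x - x], which is not complex linear. *)
Lemma closed_ker_bounded (U V : normedModType C) (f : U -> V) (M : C) :
  0 <= M -> {morph f : x y / x - y} -> (forall x, `|f x| <= M * `|x|) ->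
  closed [set x | f x = 0].
Proof.
move=> M0 fB fM; apply: closed_norm => x Hx; apply: norm_lt_all_eq0 => e e0.
(* Dividing by [M + 1] is safe even when [M = 0]. *)
have M1 : 0 < M + 1 by rewrite ltr_wpDl.
have [|z /= fz xz] := Hx (e / (M + 1)); first by rewrite divr_gt0.
rewrite -[f x]subr0 -fz -fB (le_lt_trans (fM _))//.
rewrite (@le_lt_trans _ _ ((M + 1) * `|x - z|)) //.
  by rewrite ler_wpM2r// lerDl.
by rewrite mulrC -ltr_pdivlMr.
Qed.

Lemma closed_preimage_bounded (U V : normedModType C) (f : U -> V) (M : C)
    (D : set V) :
  0 <= M -> {morph f : x y / x - y} -> (forall x, `|f x| <= M * `|x|) ->
  closed D -> closed (f @^-1` D).
Proof.
move=> M0 fB fM cD; apply: closed_norm => x Hx; apply: cD.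
apply/closureP_norm => e e0.
have M1 : 0 < M + 1 by rewrite ltr_wpDl.
have [|z /= fz xz] := Hx (e / (M + 1)); first by rewrite divr_gt0.
exists (f z) => //; rewrite -fB (le_lt_trans (fM _))//.
rewrite (@le_lt_trans _ _ ((M + 1) * `|x - z|)) //.
  by rewrite ler_wpM2r// lerDl.
by rewrite mulrC -ltr_pdivlMr.
Qed.

Lemma closed_ball_le (V : normedModType C) (r : R) :
  closed [set x : V | `|x| <= r%:C].
Proof.
apply: closed_norm => x Hx /=.
rewrite -(@RRe_real _ `|x|) ?normr_real // lecR; apply/ler_addgt0Pr => e e0.
have [|z /= zr xz] := Hx e%:C; first by rewrite ltcR.
rewrite -lecR rmorphD /= RRe_real ?normr_real // -[x](subrK z) addrC.
by rewrite (le_trans (ler_normD _ _))// lerD// ltW.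
Qed.

Lemma half_steps_cvg (V : completeNormedModType C) (y : nat -> V) :
  (forall n, `|y n.+1 - y n| <= 2^-1 ^+ n) ->
  exists l, forall e : C, 0 < e ->
    exists N, forall n, (N <= n)%N -> `|y n - l| < e.
Proof.
move=> ystep.
have h0 n : 0 <= (2^-1 : C) ^+ n by rewrite exprn_ge0.
have ydist n m : `|y (n + m)%N - y n| <= 2 * 2^-1 ^+ n.
  (* The subtracted tail of the geometric series is what lets the induction on [m] close. *)
  suff : `|y (n + m)%N - y n| <= 2 * 2^-1 ^+ n - 2 * 2^-1 ^+ (n + m).
    by move/le_trans; apply; rewrite lerBlDr lerDl mulr_ge0.
  elim: m => [|m IH]; first by rewrite addn0 !subrr normr0.
  have -> : y (n + m.+1)%N - y n =
      (y (n + m).+1 - y (n + m)%N) + (y (n + m)%N - y n).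
    by rewrite addrA subrK addnS.
  apply: (le_trans (ler_normD _ _)); apply: (le_trans (lerD (ystep _) IH)).
  rewrite addnS exprS mulrA divff // mul1r.
  by rewrite addrCA lerD2l mulr_natl mulr2n opprD addrA subrr sub0r.
have /cauchy_cvgP/cvg_ex[l yl] : cauchy (y @ \oo).
  apply/cauchy_ballP => e e0; near_simpl.
  have [N HN] := @complex_expn_half_lt (e / 4) (divr_gt0 e0 (ltr0n _ 4)).
  have HN' n : (N <= n)%N -> `|y n - y N| < e / 2.
    move=> /subnKC <-; apply: (le_lt_trans (ydist _ _)).
    rewrite -ltr_pdivlMl// (lt_le_trans HN)//.
    by rewrite mulrCA -invfM -natrM.
  exists ([set n | (N <= n)%N], [set n | (N <= n)%N]).
    by split; exists N => // n.
  move=> [n m] [/= Nn Nm]; rewrite -ball_normE /=.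
  have -> : y n - y m = (y n - y N) - (y m - y N) by rewrite opprB addrA subrK.
  rewrite (le_lt_trans (ler_normB _ _))// [e]splitr ltrD// HN'//.
exists l => e e0; move/cvgrPdist_lt: yl => /(_ e e0)[N _ HN].
by exists N => n Nn; rewrite distrC; apply: HN.
Qed.

End BanachLemmas.

(** * Unitaries in C*-algebras *)

Section CStarBasics.
Variables (R : realType) (A : cstarAlgType R).
Local Notation C := R[i].
Implicit Types (x y u : A) (c : C).

Lemma half_double (V : lmodType C) (v : V) : 2^-1 *: (v + v) = v.
Proof. by rewrite -mulr2n -(scaler_nat 2 v) scalerA mulVf ?pnatr_eq0// scale1r. Qed.

Lemma starD x y : star (x + y) = star x + star y.
Proof. by rewrite -[x in LHS]scale1r star_antilinear conjC1 scale1r. Qed.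

Lemma star0 : star (0 : A) = 0.
Proof. by apply: (addrI (star 0)); rewrite -starD !addr0. Qed.

Lemma starZ c x : star (c *: x) = Num.conj c *: star x.
Proof. by rewrite -[c *: x]addr0 star_antilinear star0 addr0. Qed.

Lemma conjC_half : Num.conj (2^-1 : C) = 2^-1.
Proof. by apply: conj_Creal; rewrite rpredV realn. Qed.

Lemma starN x : star (- x) = - star x.
Proof. by rewrite -scaleN1r starZ rmorphN1 scaleN1r. Qed.

Lemma starB x y : star (x - y) = star x - star y.
Proof. by rewrite starD starN. Qed.

Lemma starM x y : star (x * y) = star y * star x.
Proof. exact: star_mul. Qed.

Lemma star1 : star (1 : A) = 1.
Proof. by rewrite -[LHS]mulr1 -{2}[1]starK -starM mulr1 starK. Qed.

Lemma cnormM x y : `|x * y| <= `|x| * `|y|.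
Proof. exact: cstar_norm_mul. Qed.

Lemma cnorm_starM x : `|star x * x| = `|x| ^+ 2.
Proof. exact: cstar_norm_star. Qed.

Lemma cnorm_star x : `|star x| = `|x|.
Proof.
suff le y : `|y| <= `|star y|.
  by apply/eqP; rewrite eq_le le -{2}[x]starK le.
have [->|y0] := eqVneq y 0; first by rewrite normr0.
have ny : 0 < `|y| by rewrite normr_gt0.
by rewrite -(ler_pM2r ny) -expr2 -cnorm_starM cnormM.
Qed.

Lemma cnorm1 : `|1 : A| = 1.
Proof.
have n1 : `|1 : A| != 0 by rewrite normr_eq0 oner_neq0.
by apply: (mulfI n1); rewrite mulr1 -expr2 -cnorm_starM star1 mulr1.
Qed.

Definition unitary u := star u * u = 1 /\ u * star u = 1.

Lemma cnorm_unitary u : unitary u -> `|u| = 1.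
Proof.
move=> [uu _]; apply/eqP; rewrite -(@eqrXn2 _ 2)// expr1n -cnorm_starM uu.
by rewrite cnorm1.
Qed.

Lemma unitary_star u : unitary u -> unitary (star u).
Proof. by move=> [u1 u2]; split; rewrite starK. Qed.

(* The iteration y <- (k + y^2)/2 converges to 1 - sqrt (1 - k). *)
Lemma one_minus_sqrt k (h : A) :
  star k = k -> `|k| <= 3 / 4 -> k * h = h * k ->
  exists y, [/\ star y = y, y * h = h * y & y + y = k + y * y].
Proof.
move=> sk k34 kh.
pose F y : A := 2^-1 *: (k + y * y).
pose y n := iter n F 0.
have n2 : `|2^-1 : C| = 2^-1 by rewrite ger0_norm.
(* The bound [3 / 4] on [k] is chosen so that [F] maps the ball of radius [2^-1] into itself. *)
have half3 : (2^-1 * (3 / 4 + 2^-1 * 2^-1) : C) = 2^-1.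
  by field.
have yb n : `|y n| <= 2^-1.
  elim: n => [|n IH]; first by rewrite normr0.
  rewrite normrZ n2 -[leRHS]half3 ler_wpM2l//.
  apply: (le_trans (ler_normD _ _)); apply: lerD => //.
  by apply: (le_trans (cnormM _ _)); apply: ler_pM.
have sqdist (a b : A) : `|a| <= 2^-1 -> `|b| <= 2^-1 -> `|a * a - b * b| <= `|a - b|.
  move=> ab bb; have -> : a * a - b * b = a * (a - b) + (a - b) * b.
    by rewrite mulrBr mulrBl addrA subrK.
  apply: (le_trans (ler_normD _ _)).
  apply: le_trans (lerD (cnormM a (a - b)) (cnormM (a - b) b)) _.
  rewrite [leRHS](_ : _ = 2^-1 * `|a - b| + `|a - b| * 2^-1); last by field.
  by apply: lerD; [apply: ler_wpM2r|apply: ler_wpM2l].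
(* Squaring is 1-Lipschitz on this ball, so [F] is a contraction with factor [2^-1]. *)
have Fdist (a b : A) : `|a| <= 2^-1 -> `|b| <= 2^-1 -> `|F a - F b| <= 2^-1 * `|a - b|.
  move=> ab bb; rewrite -scalerBr normrZ n2 ler_wpM2l//.
  by rewrite opprD addrACA subrr add0r sqdist.
have ystep n : `|y n.+1 - y n| <= 2^-1 ^+ n.
  elim: n => [|n IH].
    by rewrite expr0 subr0 (le_trans (yb 1%N))// invf_le1// ler1n.
  have := Fdist (y n.+1) (y n) (yb _) (yb _).
  by move/le_trans; apply; rewrite exprS ler_wpM2l.
have [l yl] := half_steps_cvg ystep.
(* Self-adjointness and commutation with [h] are closed conditions satisfied by every iterate, hence
   by the limit. *)
have lim_closed (D : set A) : closed D -> (forall n, D (y n)) -> D l.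
  move=> cD Dy; apply: cD; apply/closureP_norm => e e0.
  by have [N HN] := yl e e0; exists (y N) => //; rewrite distrC HN.
have hb : `|l| <= 2^-1.
  have -> : (2^-1 : C) = (2^-1)%:C by rewrite fmorphV rmorph_nat.
  apply: (lim_closed [set x | `|x| <= (2^-1)%:C]); first exact: closed_ball_le.
  by move=> n /=; rewrite fmorphV rmorph_nat.
exists l; split.
- apply/eqP; rewrite -subr_eq0; apply/eqP.
  apply: (lim_closed [set x | star x - x = 0]).
    apply: (@closed_ker_bounded _ _ _ _ 2) => //.
      by move=> a b; rewrite starB !opprD addrACA.
    move=> x; apply: (le_trans (ler_normB _ _)).
    by rewrite cnorm_star mulr_natl.
  elim=> [|n /eqP]; first by rewrite /= star0 subr0.
  rewrite subr_eq0 => /eqP IH /=; rewrite starZ starD sk starM IH.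
  by rewrite conjC_half subrr.
- apply/eqP; rewrite -subr_eq0; apply/eqP.
  apply: (lim_closed [set x | x * h - h * x = 0]).
    apply: (@closed_ker_bounded _ _ _ _ (2 * `|h|)) => //.
      by move=> a b; rewrite mulrBl mulrBr !opprD addrACA.
    move=> x; apply: (le_trans (ler_normB _ _)).
    apply: le_trans (lerD (cnormM x h) (cnormM h x)) _.
    by rewrite [`|x| * _]mulrC -mulr2n -mulrA mulr_natl.
  elim=> [|n /eqP]; first by rewrite /= mul0r mulr0 subr0.
  rewrite subr_eq0 => /eqP IH /=; apply/eqP; rewrite subr_eq0; apply/eqP.
  by rewrite /F -scalerAl -scalerAr mulrDl mulrDr kh -mulrA IH mulrA IH mulrA.
- have fix_l : l = F l.
    apply/eqP; rewrite -subr_eq0; apply/eqP; apply: norm_lt_all_eq0 => e e0.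
    have [N HN] := yl (e / 2) (divr_gt0 e0 (ltr0n _ 2)).
    have -> : l - F l = (l - y N.+1) + (F (y N) - F l) by rewrite addrA subrK.
    apply: (le_lt_trans (ler_normD _ _)); rewrite [e]splitr; apply: ltr_leD.
      by rewrite distrC HN.
    apply: (le_trans (Fdist _ _ (yb _) hb)); apply: ltW.
    apply: (@le_lt_trans _ _ `|y N - l|); last by rewrite HN.
    by rewrite ler_piMl// invf_le1// ler1n.
  by rewrite -[RHS]half_double scalerDr; congr (_ + _).
Qed.

Lemma selfadjoint_unitary (h : A) : star h = h -> `|h| <= 2^-1 ->
  exists2 u, unitary u & h = 2^-1 *: (u + star u).
Proof.
move=> sh hb.
have [||//|y [sy yh yy]] := @one_minus_sqrt (h * h) h.
- by rewrite starM sh.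
- apply: (le_trans (cnormM _ _)); apply: (@le_trans _ _ (2^-1 * 2^-1)).
    by apply: ler_pM.
  rewrite [leLHS](_ : _ = 1 / 4); last by field.
  by rewrite ler_pM2r ?invr_gt0 ?ltr0n// ler1n.
- by rewrite mulrA.
(* The equation for [y] says that [v] squares to [1 - h * h]; as [v] commutes with [h], the element
   [h + 'i *: v] is unitary with real part [h]. *)
pose v := 1 - y.
have sv : star v = v by rewrite starB star1 sy.
have vh : v * h = h * v by rewrite mulrBl mulrBr mul1r mulr1 yh.
have vv : h * h + v * v = 1.
  have e : y - y * y = h * h - y.
    by apply/eqP; rewrite subr_eq addrAC eq_sym subr_eq -yy.
  have -> : v * v = 1 - h * h.
    by rewrite /v mulrBl mul1r mulrBr mulr1 e opprB addrA subrK.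
  by rewrite addrC subrK.
have su : star (h + 'i *: v) = h - 'i *: v.
  by rewrite starD starZ conjCi scaleNr sh sv.
exists (h + 'i *: v); first split.
- rewrite su mulrBl !mulrDr -!scalerAl -!scalerAr scalerA mulCii scaleN1r vh.
  by rewrite opprD opprK addrA addrK.
- rewrite su mulrDl !mulrBr -!scalerAl -!scalerAr scalerA mulCii scaleN1r vh.
  by rewrite opprK addrA subrK.
by rewrite su addrACA subrr addr0 half_double.
Qed.

(** Write [x = a + 'i *: b] with [a], [b] self-adjoint. If [x] has norm at most [2^-1], each part is
    half a sum of two unitaries, so [f x] has norm at most 2; scaling gives the constant 4. *)
Lemma bounded_on_unitaries (V : normedModType C) (f : A -> V) :
  linear f -> (forall u, unitary u -> `|f u| <= 1) ->
  forall x, `|f x| <= 4 * `|x|.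
Proof.
move=> flin fu.
pose fL := GRing.isLinear.Build _ _ _ _ f flin.
pose F : {linear A -> V} := HB.pack f fL.
have fD x y : f (x + y) = f x + f y by rewrite -[f]/(F : A -> V) linearD.
have fZ c x : f (c *: x) = c *: f x by rewrite -[f]/(F : A -> V) linearZ.
have fh h : star h = h -> `|h| <= 2^-1 -> `|f h| <= 1.
  move=> sh /(selfadjoint_unitary sh)[u uu ->].
  rewrite fZ normrZ ger0_norm// fD -[leRHS](@mulVf _ 2)// ler_wpM2l//.
  apply: (le_trans (ler_normD _ _)).
  by apply: lerD; apply: fu => //; exact: unitary_star.
have fsmall x : `|x| <= 2^-1 -> `|f x| <= 2.
  move=> xb.
  pose a := 2^-1 *: (x + star x); pose b := (2^-1 * 'i) *: (star x - x).
  have xab : x = a + 'i *: b.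
    rewrite /a /b scalerA mulrCA mulCii mulrN1 scaleNr -scalerBr opprB.
    by rewrite addrACA subrr addr0 half_double.
  have sa : star a = a by rewrite starZ conjC_half starD starK addrC.
  have sb : star b = b.
    rewrite starZ rmorphM /= conjC_half conjCi starB starK mulrN scaleNr.
    by rewrite -scalerN opprB.
  have xx : 2^-1 * (`|x| + `|x|) = `|x| by field.
  have ab : `|a| <= 2^-1.
    rewrite normrZ ger0_norm// (le_trans _ xb)// -[leRHS]xx ler_wpM2l//.
    by rewrite (le_trans (ler_normD _ _))// cnorm_star.
  have bb : `|b| <= 2^-1.
    rewrite normrZ normrM normCi mulr1 ger0_norm// (le_trans _ xb)//.
    rewrite -[leRHS]xx ler_wpM2l//.
    by rewrite (le_trans (ler_normB _ _))// cnorm_star.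
  rewrite xab fD (fZ 'i) (le_trans (ler_normD _ _))// normrZ normCi mul1r.
  by rewrite [leRHS](_ : 2 = 1 + 1)// lerD// fh.
move=> x; have [->|x0] := eqVneq x 0.
  by rewrite -[f]/(F : A -> V) linear0 !normr0 mulr0.
have nx : 0 < `|x| by rewrite normr_gt0.
have := fsmall ((2 * `|x|)^-1 *: x).
rewrite normrZ ger0_norm; last by rewrite invr_ge0 mulr_ge0.
rewrite invfM -mulrA mulVf ?gt_eqF// mulr1 => /(_ (lexx _)).
rewrite fZ normrZ ger0_norm; last by rewrite mulr_ge0 ?invr_ge0.
rewrite -invfM mulrC ler_pdivrMr; last by rewrite mulr_gt0.
by rewrite mulrA -natrM.
Qed.

End CStarBasics.

(** * States *)

Section States.
Variables (R : realType) (A : cstarAlgType R).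
Local Notation C := R[i].
Implicit Types (x y u : A) (c : C) (w : A -> C).

Lemma stateP w c x y : is_state w -> w (c *: x + y) = c * w x + w y.
Proof. by move=> [wl _ _]; rewrite wl. Qed.

Lemma state0 w : is_state w -> w 0 = 0.
Proof.
move=> sw; have /eqP := stateP 1 0 0 sw; rewrite scale1r addr0 mul1r.
by rewrite -subr_eq0 opprD addrA subrr sub0r oppr_eq0 => /eqP.
Qed.

Lemma stateD w x y : is_state w -> w (x + y) = w x + w y.
Proof. by move=> sw; rewrite -[x in LHS]scale1r stateP// mul1r. Qed.

Lemma stateZ w c x : is_state w -> w (c *: x) = c * w x.
Proof. by move=> sw; rewrite -[c *: x]addr0 stateP// state0// addr0. Qed.

Lemma stateN w x : is_state w -> w (- x) = - w x.
Proof. by move=> sw; rewrite -scaleN1r stateZ// mulN1r. Qed.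

Lemma stateB w x y : is_state w -> w (x - y) = w x - w y.
Proof. by move=> sw; rewrite stateD// stateN. Qed.

Lemma state_sum w (I : Type) (s : seq I) (F : I -> A) : is_state w ->
  w (\sum_(i <- s) F i) = \sum_(i <- s) w (F i).
Proof.
by move=> sw; elim/big_ind2: _ => [|? ? ? ? <- <-|]//; [exact: state0|exact: stateD].
Qed.

(** Positivity at [y + 1] makes [w (star y) + w y] real; taking [y = x] and [y = 'i *: x] determines
    [w (star x)]. *)
Lemma state_star w x : is_state w -> w (star x) = Num.conj (w x).
Proof.
move=> sw.
have re y : w (star y) + w y \is Num.real.
  have := state_positive sw (y + 1).
  rewrite starD star1 mulrDl !mulrDr !mul1r !mulr1 !stateD// state_normalized//.
  rewrite -addrA => h; have yy := state_positive sw y.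
  have : w (star y * y) + (w (star y) + (w y + 1)) - w (star y * y) - 1 \is Num.real.
    by rewrite !rpredB ?ger0_real.
  by rewrite [_ + (w (star y) + _)]addrC addrK !addrA addrK.
have h1 : (w (star x) + w x)^* = w (star x) + w x by exact/CrealP.
have h2 : ('i * (w x - w (star x)))^* = 'i * (w x - w (star x)).
  apply/CrealP; have := re ('i *: x); rewrite starZ conjCi !stateZ//.
  by rewrite mulNr mulrBr addrC.
move: h1 h2; rewrite rmorphD rmorphM rmorphB /= conjCi mulNr -mulrN opprB.
move=> h1 /(mulfI (neq0Ci _)) h2.
have h3 : (w x)^* + (w x)^* = w (star x) + w (star x).
  have -> : (w x)^* + (w x)^* = ((w (star x))^* + (w x)^*) -
      ((w (star x))^* - (w x)^*) by rewrite opprB [RHS]addrC addrA subrK.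
  by rewrite h1 h2; ring.
by apply: (@mulfI _ 2); rewrite ?pnatr_eq0// !mulr_natl !mulr2n.
Qed.

(** The variance of [x], that is [w] at the square of [x - w x *: 1], is nonnegative. *)
Lemma state_star_ge w x : is_state w -> `|w x| ^+ 2 <= w (star x * x).
Proof.
move=> sw; have := state_positive sw (x - w x *: 1).
rewrite starB starZ star1 mulrBl !mulrBr -!scalerAl -!scalerAr !mulr1 !mul1r.
rewrite !stateB// !stateZ// state_normalized// mulr1 state_star//.
by rewrite [_^* * _]mulrC subrr subr0 -normCK subr_ge0.
Qed.

Lemma state_unitary_le1 w u : is_state w -> unitary u -> `|w u| <= 1.
Proof.
move=> sw [uu _]; have := state_star_ge u sw.
by rewrite uu state_normalized// expr_le1.
Qed.

Lemma state_bounded w x : is_state w -> `|w x| <= 4 * `|x|.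
Proof.
move=> sw; apply: (@bounded_on_unitaries R A R[i]^o w).
  by move=> c a b; rewrite stateP.
by move=> u uu; exact: state_unitary_le1.
Qed.

(** The degenerate case of the Cauchy-Schwarz inequality, which makes null vectors a left ideal. *)
Lemma state_null w x y : is_state w -> w (star y * y) = 0 -> w (x * y) = 0.
Proof.
move=> sw yy; set a := w (x * y).
pose M := w (x * star x).
have M0 : 0 <= M by rewrite /M -{1}[x]starK state_positive.
have key n : n%:R * `|a| ^+ 2 <= M.
  have := state_positive sw (star x - (n%:R * a^*) *: y).
  rewrite starB starK starZ mulrBl !mulrBr -!scalerAl -!scalerAr.
  rewrite !stateB// !stateZ// yy !mulr0 subr0 -/a -/M.
  have -> : w (star y * star x) = a^* by rewrite -starM state_star.
  have -> : (n%:R * a^*)^* = n%:R * a by rewrite rmorphM /= conjCK conjC_nat.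
  have nn : n%:R * `|a| ^+ 2 = n%:R * a * a^* by rewrite normCK mulrA.
  have -> : n%:R * a^* * a = n%:R * `|a| ^+ 2 by rewrite nn mulrAC.
  rewrite -nn => h.
  have p : 0 <= n%:R * `|a| ^+ 2 by rewrite mulr_ge0// exprn_ge0.
  by move: h; rewrite -addrA -opprD subr_ge0; apply: le_trans; rewrite lerDl.
apply/eqP; apply: contraT => a0.
have a2 : 0 < `|a| ^+ 2 by rewrite exprn_gt0// normr_gt0.
have /complex_gt0_real[r r0 rE] : 0 < (M + 1) / `|a| ^+ 2.
  by rewrite divr_gt0// ltr_wpDl.
suff lt : M < (Num.bound r)%:R * `|a| ^+ 2.
  by have := le_lt_trans (key (Num.bound r)) lt; rewrite ltxx.
rewrite -ltr_pdivrMr//; apply: (@le_lt_trans _ _ r%:C).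
  by rewrite -rE ler_pM2r ?invr_gt0// lerDl.
rewrite -(rmorph_nat (real_complex R)) ltcR.
by apply: archi_boundP; exact: ltW.
Qed.

(** The variance of a unitary [u] is 1 minus the squared modulus of [w u]. *)
Lemma state_eigen_null w u : is_state w -> unitary u -> `|w u| = 1 ->
  w (star (u - w u *: 1) * (u - w u *: 1)) = 0.
Proof.
move=> sw [uu _] wu.
rewrite starB starZ star1 mulrBl !mulrBr -!scalerAl -!scalerAr !mulr1 !mul1r.
rewrite !stateB// !stateZ// uu state_normalized// mulr1 state_star//.
by rewrite [_^* * _]mulrC subrr subr0 -normCK wu expr1n subrr.
Qed.

Lemma state_eigen w u : is_state w -> unitary u -> `|w u| = 1 ->
  forall x, w (x * u) = w x * w u.
Proof.
move=> sw uu wu x; have := state_null x sw (state_eigen_null sw uu wu).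
rewrite mulrBr -scalerAr mulr1 stateB// stateZ// mulrC.
by move/eqP; rewrite subr_eq0 => /eqP.
Qed.

(** Obtained from [state_eigen] for [star u] by taking adjoints. *)
Lemma state_eigenl w u : is_state w -> unitary u -> `|w u| = 1 ->
  forall x, w (u * x) = w u * w x.
Proof.
move=> sw uu wu x.
rewrite -[u * x]starK state_star// starM.
rewrite state_eigen//; last 2 first.
- exact: unitary_star.
- by rewrite state_star// norm_conjC.
by rewrite !state_star// rmorphM /= !conjCK mulrC.
Qed.

(** In the GNS picture, the cyclic vector is replaced by its normalised image under [y]. *)
Lemma state_compress w y : is_state w -> w (star y * y) != 0 ->
  is_state (fun x => w (star y * x * y) / w (star y * y)).
Proof.
move=> sw yy; split.
- move=> c a b; rewrite mulrDr mulrDl -scalerAr -scalerAl stateP// mulrDl.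
  by rewrite mulrA.
- move=> x; apply: divr_ge0; last exact: state_positive.
  by rewrite -mulrA -[_ * y]mulrA mulrA -starM state_positive.
- by rewrite mulr1 divff.
Qed.

Lemma state_average w1 w2 : is_state w1 -> is_state w2 ->
  is_state (fun x => 2^-1 * (w1 x + w2 x)).
Proof.
move=> s1 s2; split.
- move=> c a b; rewrite !stateP// mulrCA -mulrDr; congr (_ * _).
  by rewrite mulrDr addrACA.
- by move=> x; rewrite mulr_ge0// addr_ge0// state_positive.
- by rewrite !state_normalized// mulVf// pnatr_eq0.
Qed.

End States.

(** * Weak-* compactness of the state space, by ultrafilters *)

Section StateCompactness.
Variable R : realType.
Local Notation C := R[i].

Lemma ultra_bounded_real (X : Type) (G : set_system X) (f : X -> R) (M : R) :
  UltraFilter G -> (\forall w \near G, `|f w| <= M) ->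
  exists r, forall e : R, 0 < e -> \forall w \near G, `|f w - r| < e.
Proof.
move=> GU fM; have PG : ProperFilter G by exact: ultra_proper.
have Pf : ProperFilter (f @ G) by exact: fmap_proper_filter.
have [|r [_ clr]] := @segment_compact R (- M) M (f @ G) Pf.
  by apply: filterS fM => w; rewrite /= in_itv /= ler_norml.
exists r => e e0.
(* If the ultrafilter missed this set it would contain the complement, contradicting that [r] is a
   cluster point. *)
have [//|far] := in_ultra_setVsetC [set w | `|f w - r| < e] GU.
have [||t [/= ft]] := clr [set t | ~ `|t - r| < e] (ball r e).
- exact: far.
- exact: nbhsx_ballx.
by rewrite -ball_normE /= distrC.
Qed.

Lemma ultra_bounded_complex (X : Type) (G : set_system X) (f : X -> C) (M : R) :
  UltraFilter G -> (\forall w \near G, `|f w| <= M%:C) ->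
  exists l, forall e : C, 0 < e -> \forall w \near G, `|f w - l| < e.
Proof.
move=> GU fM; have PG : ProperFilter G by exact: ultra_proper.
have [|r Hr] := @ultra_bounded_real X G (fun w => complex.Re (f w)) M GU.
- apply: filterS fM => w fw; rewrite -lecR; apply: le_trans fw.
  exact: normc_ge_Re.
have [|s Hs] := @ultra_bounded_real X G (fun w => complex.Im (f w)) M GU.
- apply: filterS fM => w fw; rewrite -lecR; apply: le_trans fw.
  have -> : complex.Im (f w) = complex.Re (- 'i%C * f w).
    by case: (f w) => a b /=; ring.
  apply: (le_trans (normc_ge_Re _)); rewrite normrM normrN.
  by rewrite complexiE normCi mul1r.
exists (r +i* s) => e /complex_gt0_real[d d0 ->].
near=> w.
have -> : f w - (r +i* s) = (complex.Re (f w) - r)%:C +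
    'i%C * (complex.Im (f w) - s)%:C.
  by case: (f w) => a b; apply/eqP; rewrite eq_complex /=; apply/andP; split;
    apply/eqP; ring.
apply: (le_lt_trans (ler_normD _ _)); rewrite normrM complexiE normCi mul1r.
rewrite !normc_def /= !expr0n /= !addr0 !sqrtr_sqr -rmorphD ltcR [d]splitr.
apply: ltrD.
  by near: w; apply: Hr; rewrite divr_gt0.
by near: w; apply: Hs; rewrite divr_gt0.
Unshelve. all: by end_near. Qed.

(** The finite approximate conditions generate a proper filter on functionals. Along a finer
    ultrafilter the values at each [z] stay bounded by [4 * |z|] and converge, and the pointwise
    limit is a state with the exact values. *)
Lemma state_compactness (A : cstarAlgType R) (I : eqType) (x : I -> A)
    (c : I -> C) :
  (forall (s : seq I) (e : C), 0 < e -> exists2 w, is_state w &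
      forall i, i \in s -> `|w (x i) - c i| < e) ->
  exists2 w, is_state w & forall i, w (x i) = c i.
Proof.
move=> Hfin.
pose F : set_system (A -> C) := [set P | exists (s : seq I) (e : C), 0 < e /\
  forall w, is_state w -> (forall i, i \in s -> `|w (x i) - c i| < e) -> P w].
have PF : ProperFilter F.
  apply: Build_ProperFilter_ex.
    by move=> P [s [e [e0 sP]]]; have [w sw wP] := Hfin s e e0; exists w; apply: sP.
  split.
  - by exists [::], 1; split.
  - move=> P Q [s [e [e0 sP]]] [t [d [d0 tQ]]].
    exists (s ++ t), (Num.min e d).
    (* The order on [R[i]] is partial, so the minimum needs comparability, which holds for real
       numbers. *)
    have ed : (e >=< d)%O by apply: real_comparable; apply: gtr0_real.
    split; first by rewrite comparable_lt_min ?e0 ?d0.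
    move=> w sw wb; split; [apply: sP|apply: tQ] => // i ii.
      have := wb i; rewrite mem_cat ii => /(_ isT).
      by rewrite comparable_lt_min// => /andP[].
    have := wb i; rewrite mem_cat ii orbT => /(_ isT).
    by rewrite comparable_lt_min// => /andP[].
  - move=> P Q PQ [s [e [e0 sP]]]; exists s, e; split => // w sw wb.
    by apply: PQ; exact: sP.
have [G [GU FG]] := ultraFilterLemma PF.
have PG : ProperFilter G by exact: ultra_proper.
have Gs : \forall w \near G, is_state w.
  by apply: FG; exists [::], 1; split.
have Gc i e : 0 < e -> \forall w \near G, `|w (x i) - c i| < e.
  move=> e0; apply: FG; exists [:: i], e; split => // w _; apply.
  by rewrite mem_seq1.
have /choice[w0 Gw] : forall z : A, exists l : C, forall e : C, 0 < e ->
    \forall w \near G, `|w z - l| < e.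
  move=> z; apply: (@ultra_bounded_complex _ _ _ (complex.Re (4 * `|z|))) => //.
  apply: filterS Gs => w sw.
  by rewrite RRe_real ?state_bounded// ger0_real// mulr_ge0.
exists w0; first split.
- move=> d a b; apply/eqP; rewrite -subr_eq0; apply/eqP.
  apply: (@norm_lt_all_eq0 R C^o) => e e0.
  have d1 : 0 < `|d| + 1 by rewrite ltr_wpDl.
  have : \forall w \near G, `|w0 (d *: a + b) - (d * w0 a + w0 b)| < e.
    near=> w.
    have sw : is_state w by near: w.
    rewrite [X in `|X|](_ : _ = - (w (d *: a + b) - w0 (d *: a + b)) +
        (d * (w a - w0 a) + (w b - w0 b))); last by rewrite (stateP _ _ _ sw); ring.
    rewrite [e](_ : _ = e / 2 + (e / 4 + e / 4)); last by field.
    apply: (le_lt_trans (ler_normD _ _)); rewrite normrN; apply: ltrD.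
      by near: w; apply: Gw; rewrite divr_gt0.
    apply: (le_lt_trans (ler_normD _ _)); apply: ler_ltD.
      rewrite normrM; apply: (@le_trans _ _ ((`|d| + 1) * `|w a - w0 a|)).
        by rewrite ler_wpM2r// lerDl.
      rewrite mulrC -ler_pdivlMr//; apply: ltW.
      by near: w; apply: Gw; rewrite !divr_gt0.
    by near: w; apply: Gw; rewrite divr_gt0.
  by move/filter_ex => [].
- move=> a; set z := star a * a.
  (* Being equal to its own norm expresses nonnegativity as an equation that passes to the limit. *)
  suff -> : w0 z = `|w0 z| by [].
  suff /eqP : `|w0 z| - w0 z = 0 by rewrite subr_eq0 => /eqP.
  apply: (@norm_lt_all_eq0 R C^o) => e e0.
  have : \forall w \near G, `| `|w0 z| - w0 z| < e.
    near=> w; have sw : is_state w by near: w.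
    have wz : `|w z - w0 z| < e / 2 by near: w; apply: Gw; rewrite divr_gt0.
    have -> : `|w0 z| - w0 z = - (`|w z| - `|w0 z|) + (w z - w0 z).
      have -> : `|w z| = w z by apply: ger0_norm; exact: state_positive.
      by ring.
    rewrite [e]splitr (le_lt_trans (ler_normD _ _))// normrN ltrD//.
    by apply: le_lt_trans wz; exact: ler_dist_dist.
  by move/filter_ex => [].
- apply/eqP; rewrite -subr_eq0; apply/eqP; apply: (@norm_lt_all_eq0 R C^o) => e e0.
  have : \forall w \near G, `|w0 1 - 1| < e.
    near=> w; have sw : is_state w by near: w.
    rewrite -(state_normalized sw) distrC.
    by near: w; exact: Gw.
  by move/filter_ex => [].
- move=> i; apply/eqP; rewrite -subr_eq0; apply/eqP.
  apply: (@norm_lt_all_eq0 R C^o) => e e0.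
  have : \forall w \near G, `|w0 (x i) - c i| < e.
    near=> w.
    rewrite [X in `|X|](_ : _ = - (w (x i) - w0 (x i)) + (w (x i) - c i));
      last by ring.
    rewrite [e]splitr (le_lt_trans (ler_normD _ _))// normrN ltrD//.
      by near: w; apply: Gw; rewrite divr_gt0.
    by near: w; apply: Gc; rewrite divr_gt0.
  by move/filter_ex => [].
Unshelve. all: by end_near. Qed.

End StateCompactness.

(** * States invariant under a commutative group of unitaries *)

Section TranslationInvariantState.
Variables (R : realType) (A : cstarAlgType R) (L : zmodType) (V : L -> A).
Local Notation C := R[i].
Hypothesis V0 : V 0 = 1.
Hypothesis VD : forall a b, V a * V b = V (a + b).
Hypothesis V_star : forall a, star (V a) = V (- a).
Implicit Types (w : A -> C) (l : L).

Lemma state_conj w (u : A) : is_state w -> unitary u ->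
  is_state (fun x => w (star u * x * u)).
Proof.
move=> sw [uu _]; split.
- by move=> c a b; rewrite mulrDr mulrDl -scalerAr -scalerAl stateP.
- by move=> x; rewrite -mulrA -[_ * u]mulrA mulrA -starM state_positive.
- by rewrite mulr1 uu state_normalized.
Qed.

(* Averaging a state over the identity and a unitary that sends [V l] to
   [- V l] kills [V l], and keeps the zeros already obtained. *)
Lemma delta_state w0 : is_state w0 ->
  (forall l, l != 0 -> exists2 u, unitary u &
     star u * V l * u = - V l /\
     forall l', exists c : C, star u * V l' * u = c *: V l') ->
  exists2 w, is_state w & forall l, w (V l) = (l == 0)%:R.
Proof.
move=> sw0 flip; apply: state_compactness => s e e0.
(* Any finite list of labels is killed exactly, by induction on the list. *)
suff [w sw ws] : exists2 w, is_state w &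
    forall l, l \in s -> l != 0 -> w (V l) = 0.
  exists w => // l ls; have [->|l0] := eqVneq l 0.
    by rewrite V0 state_normalized// subrr normr0.
  by rewrite ws// subrr normr0.
elim: s => [|a s [w sw ws]]; first by exists w0.
have [a0|a0] := eqVneq a 0.
  exists w => // l; rewrite inE => /predU1P[->|]; last exact: ws.
  by rewrite a0 eqxx.
have [u uu [ua ul]] := flip a a0.
exists (fun x => 2^-1 * (w x + w (star u * x * u))).
  by apply: state_average => //; exact: state_conj.
move=> l; rewrite inE => /predU1P[->|ls] l0.
  by rewrite ua stateN// subrr mulr0.
by have [c ->] := ul l; rewrite stateZ// ws// mulr0 addr0 mulr0.
Qed.

(** Repetitions in the list are multiplicities, so the coefficients are natural numbers. These
    elements form a commutative semiring stable under [star]. *)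
Definition positive_comb (x : A) := exists D : seq L, x = \sum_(d <- D) V d.

Lemma positive_combV l : positive_comb (V l).
Proof. by exists [:: l]; rewrite big_seq1. Qed.

Lemma positive_comb0 : positive_comb 0.
Proof. by exists [::]; rewrite big_nil. Qed.

Lemma positive_combD x y :
  positive_comb x -> positive_comb y -> positive_comb (x + y).
Proof. by move=> [D ->] [E ->]; exists (D ++ E); rewrite big_cat. Qed.

Lemma positive_comb_sum (I : Type) (s : seq I) (P : pred I) (F : I -> A) :
  (forall i, P i -> positive_comb (F i)) ->
  positive_comb (\sum_(i <- s | P i) F i).
Proof.
by move=> FP; apply: big_ind => //; [exact: positive_comb0|exact: positive_combD].
Qed.

Lemma positive_combM x y :
  positive_comb x -> positive_comb y -> positive_comb (x * y).
Proof.
move=> [D ->] [E ->]; rewrite mulr_suml; apply: positive_comb_sum => d _.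
rewrite mulr_sumr; apply: positive_comb_sum => d' _; rewrite VD.
exact: positive_combV.
Qed.

Lemma star_sum (I : Type) (s : seq I) (F : I -> A) :
  star (\sum_(i <- s) F i) = \sum_(i <- s) star (F i).
Proof.
by elim/big_ind2: _ => [|? ? ? ? <- <-|]//; [exact: star0|rewrite starD].
Qed.

Lemma positive_comb_star x : positive_comb x -> positive_comb (star x).
Proof.
move=> [D ->]; rewrite star_sum; apply: positive_comb_sum => d _.
by rewrite V_star; exact: positive_combV.
Qed.

Lemma positive_comb_comm x y :
  positive_comb x -> positive_comb y -> x * y = y * x.
Proof.
move=> [D ->] [E ->]; rewrite mulr_suml mulr_sumr; apply: eq_bigr => d _.
rewrite mulr_sumr mulr_suml; apply: eq_bigr => d' _.
by rewrite !VD addrC.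
Qed.

(** * Folner sums and approximately invariant states *)

Section Folner.
Variables (tau : A -> C) (N : nat).
Hypothesis stau : is_state tau.
Hypothesis tauV : forall l, tau (V l) = (l == 0)%:R.
Hypothesis N0 : (0 < N)%N.

Lemma tau_ge0 x : positive_comb x -> 0 <= tau x.
Proof.
by move=> [D ->]; rewrite state_sum// sumr_ge0// => d _; rewrite tauV ler0n.
Qed.

Definition segment_sum l := \sum_(k < N) V (l *+ k).

Lemma positive_segment_sum l : positive_comb (segment_sum l).
Proof. by apply: positive_comb_sum => k _; exact: positive_combV. Qed.

Lemma segment_sum_telescope l :
  (V l - 1) * segment_sum l = V (l *+ N) - 1.
Proof.
rewrite /segment_sum mulr_sumr.
rewrite (eq_bigr (fun k : 'I_N => V (l *+ k.+1) - V (l *+ k))); last first.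
  by move=> k _; rewrite mulrBl mul1r VD mulrS.
rewrite -(big_mkord xpredT (fun k => V (l *+ k.+1) - V (l *+ k))).
by rewrite telescope_sumr// mulr0n V0.
Qed.

(** In [star g * g] the diagonal terms give [N%:R *: 1] and the others a positive combination [r],
    whose contribution under [tau] is nonnegative. *)
Lemma tau_segment_sum_ge l y : positive_comb y ->
  N%:R * tau (star y * y) <=
    tau (star (segment_sum l * y) * (segment_sum l * y)).
Proof.
move=> Py; set g := segment_sum l.
have [r Pr gr] : exists2 r, positive_comb r & star g * g = N%:R *: 1 + r.
  exists (\sum_(j < N) \sum_(k < N | k != j) V (- (l *+ j)) * V (l *+ k)).
    apply: positive_comb_sum => j _; apply: positive_comb_sum => k _.
    by rewrite VD; exact: positive_combV.
  rewrite star_sum mulr_suml.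
  rewrite (eq_bigr (fun j : 'I_N => 1 +
      \sum_(k < N | k != j) V (- (l *+ j)) * V (l *+ k))); last first.
    move=> j _; rewrite V_star mulr_sumr (bigD1 j)//=; congr (_ + _).
    by rewrite VD addNr V0.
  by rewrite big_split /= sumr_const card_ord scaler_nat.
have -> : star (g * y) * (g * y) = N%:R *: (star y * y) + star y * r * y.
  rewrite starM -!mulrA [star g * _]mulrA gr mulrDl mulrDr -scalerAl mul1r.
  by rewrite -scalerAr.
rewrite stateD// stateZ// lerDl; apply: tau_ge0.
by do 2?apply: positive_combM => //; exact: positive_comb_star.
Qed.

(** After telescoping, the square of [V a - 1] is [2 - V a - V (- a)], and the subtracted terms
    contribute nonnegatively. The bound does not grow with [N], unlike the preceding lower bound. *)
Lemma tau_segment_shift_le l y : positive_comb y ->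
  tau (star ((V l - 1) * (segment_sum l * y)) * ((V l - 1) * (segment_sum l * y)))
    <= 2 * tau (star y * y).
Proof.
move=> Py; rewrite [(V l - 1) * (_ * y)]mulrA segment_sum_telescope; set a := l *+ N.
have -> : star ((V a - 1) * y) * ((V a - 1) * y) =
    2 *: (star y * y) - (star y * V a * y + star y * V (- a) * y).
  have -> : star ((V a - 1) * y) * ((V a - 1) * y) =
      star y * (star (V a - 1) * (V a - 1)) * y by rewrite starM !mulrA.
  have -> : star (V a - 1) * (V a - 1) = 2 *: 1 - (V a + V (- a)).
    rewrite starB star1 V_star mulrBr mulr1 mulrBl VD addNr V0 mul1r.
    by rewrite scaler_nat mulr2n opprB addrACA opprD.
  by rewrite mulrBr mulrBl -scalerAr -scalerAl mulr1 mulrDr mulrDl.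
rewrite stateB// stateZ// gerBl; apply: tau_ge0.
by apply: positive_combD; do 2?apply: positive_combM => //;
  (exact: positive_comb_star || exact: positive_combV).
Qed.

(** Take the product of the segment sums over [s]; they commute, so any one of them can be moved to
    the front. *)
Lemma folner_element (s : seq L) : exists y, [/\ positive_comb y,
  0 < tau (star y * y) & forall l, l \in s ->
    exists2 z, positive_comb z & y = segment_sum l * z].
Proof.
elim: s => [|a s [y [Py y0 ys]]].
  exists 1; split => //; last by rewrite star1 mulr1 state_normalized.
  by rewrite -V0; exact: positive_combV.
exists (segment_sum a * y); split.
- by apply: positive_combM => //; exact: positive_segment_sum.
- apply: lt_le_trans (tau_segment_sum_ge a Py).
  by rewrite mulr_gt0// ltr0n.
- move=> l; rewrite inE => /predU1P[->|ls]; first by exists y.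
  have [z Pz yz] := ys l ls; exists (segment_sum a * z).
    by apply: positive_combM => //; exact: positive_segment_sum.
  rewrite yz !mulrA; congr (_ * _).
  by apply: positive_comb_comm; exact: positive_segment_sum.
Qed.

(** Compress [tau] by [y = segment_sum l * z]: the numerator is at most [2 * tau (star z * z)] and
    the denominator at least [N%:R * tau (star z * z)]. *)
Lemma folner_state (s : seq L) : exists2 w, is_state w &
  forall l, l \in s -> w (star (V l - 1) * (V l - 1)) <= 2 / N%:R.
Proof.
have [y [Py y0 ys]] := folner_element s.
exists (fun x => tau (star y * x * y) / tau (star y * y)).
  by apply: state_compress => //; rewrite gt_eqF.
move=> l ls; have [z Pz yz] := ys l ls.
rewrite ler_pdivrMr// -mulrA -[_ * y]mulrA mulrA -starM.
rewrite {1 2}yz; apply: (le_trans (tau_segment_shift_le l Pz)).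
rewrite -mulrA ler_wpM2l// ler_pdivlMl ?ltr0n// yz.
exact: tau_segment_sum_ge.
Qed.

End Folner.

(** Compactness is applied to the squares of [V l - 1] with target 0; [state_null] then turns each
    null vector [V l - 1] into [w (V l) = 1]. *)
Lemma translation_invariant_state tau : is_state tau ->
  (forall l, tau (V l) = (l == 0)%:R) ->
  exists2 w, is_state w & forall l, w (V l) = 1.
Proof.
move=> stau tauV.
have [s e e0|w sw wV] :=
    @state_compactness R A L (fun l => star (V l - 1) * (V l - 1)) (fun=> 0).
  have [r r0 re] := complex_gt0_real e0.
  have [n nr] : exists n : nat, 2 / r < n.+1%:R.
    exists (Num.bound (2 / r)).
    apply: (@lt_trans _ _ (Num.bound (2 / r))%:R); last by rewrite ltr_nat.
    by apply: archi_boundP; rewrite divr_ge0// ltW.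
  have [w sw ws] := folner_state stau tauV (ltn0Sn n) s.
  exists w => // l ls; rewrite subr0 ger0_norm ?state_positive//.
  apply: (le_lt_trans (ws l ls)); rewrite re.
  rewrite (_ : 2 / n.+1%:R = (2 / n.+1%:R)%:C); last first.
    by rewrite fmorph_div !rmorph_nat.
  by rewrite ltcR ltr_pdivrMr ?ltr0n// mulrC -ltr_pdivrMr.
exists w => // l.
have := state_null 1 sw (wV l); rewrite mul1r stateB// state_normalized//.
by move/eqP; rewrite subr_eq0 => /eqP.
Qed.

End TranslationInvariantState.

(** * Spatial tensor products *)

Section TensorTotal.
Variables (R : realType) (U V Z : normedModType R[i]).
Variable t : {bilinear U -> V -> Z}.

Lemma tensor_total (D : set Z) : closure (tensor_sums t) = setT ->
  closed D -> D 0 -> (forall x y, D x -> D y -> D (x + y)) ->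
  (forall u v, D (t u v)) -> forall z, D z.
Proof.
move=> dense cD D0 DD Dt z; apply: cD.
have : closure (tensor_sums t) z by rewrite dense.
apply: closureS => _ [n [u [v ->]]].
by apply: big_ind => // i _; exact: Dt.
Qed.

End TensorTotal.

Section SpatialTensor.
Variables (R : realType) (A B T : cstarAlgType R).
Variable t : {bilinear A -> B -> T}.
Hypothesis spatial : is_spatial_tensor t.
Local Notation C := R[i].

Lemma repB (S : cstarAlgType R) (H : hilbertType R) (p : S -> {linear H -> H}) :
  is_representation p -> forall a b x, p (a - b) x = p a x - p b x.
Proof.
by move=> rp a b x; rewrite addrC -scaleN1r (rep_linear rp) scaleN1r addrC.
Qed.

(** The kernel of the bounded operator [P (a - b)] is a closed subspace containing all [h x y],
    hence everything, and [P] is faithful. *)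
Lemma rep_eq_on_tensors (H1 H2 K : hilbertType R) (h : {bilinear H1 -> H2 -> K})
    (P : T -> {linear K -> K}) :
  is_hilbert_tensor h -> is_faithful_representation P ->
  forall a b, (forall x y, P a (h x y) = P b (h x y)) -> a = b.
Proof.
move=> [_ dense] [rP fP] a b ab; apply/eqP; rewrite -subr_eq0; apply/eqP.
apply: fP; apply: (tensor_total (D := [set x | P (a - b) x = 0]) dense).
- have /continuous_closedP cl := @rep_bounded _ _ _ _ rP (a - b).
  apply: (cl [set x | x = 0]).
  apply: closed_norm => x Hx; apply: norm_lt_all_eq0 => e e0.
  by have [z /= ->] := Hx e e0; rewrite subr0.
- by rewrite /= linear0.
- by move=> x y /= xD yD; rewrite linearD xD yD addr0.
- by move=> x y /=; rewrite repB// ab subrr.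
Qed.

Lemma innerBl (H : hilbertType R) (x y z : H) :
  inner (x - y) z = inner x z - inner y z.
Proof. by rewrite linearBl. Qed.

Lemma innerPl (H : hilbertType R) (c : C) (x y z : H) :
  inner (c *: x + y) z = c * inner x z + inner y z.
Proof. by rewrite linearPl. Qed.

Lemma inner_sumr (H : hilbertType R) (n : nat) (x : H) (y : 'I_n -> H) :
  inner x (\sum_(i < n) y i) = \sum_(i < n) inner x (y i).
Proof. by rewrite linear_sumr. Qed.

Lemma inner_ge0 (H : hilbertType R) (x : H) : 0 <= inner x x.
Proof. by rewrite -inner_norm exprn_ge0. Qed.

(** By Pythagoras [x] is no longer than [x - y] for [y] in [S], and by density [x - y] can be made
    arbitrarily short. *)
Lemma orthogonal_dense_eq0 (H : hilbertType R) (S : set H) (x : H) :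
  closure S = setT -> (forall y, S y -> inner x y = 0) -> x = 0.
Proof.
move=> dense orth; apply: norm_lt_all_eq0 => e e0.
have : closure S x by rewrite dense.
move=> /closureP_norm /(_ e e0)[y Sy]; apply: le_lt_trans.
rewrite -(@ler_pXn2r _ 2)// ?nnegrE//.
rewrite !inner_norm (hnormBd (form := inner (s := H))); last exact: orth.
by rewrite lerDl; exact: inner_ge0.
Qed.

(** The map [t] is only given as bilinear; its compatibility with unit, product and adjoint is read
    off from the representation [P] on elementary tensors. *)
Lemma tens_algebra :
  [/\ t 1 1 = 1,
      forall a b a' b', t a b * t a' b' = t (a * a') (b * b') &
      forall a b, star (t a b) = t (star a) (star b)].
Proof.
have [_ [H1 [H2 [K [h [p1 [p2 [P [hT [r1 _] [r2 _] fP tP]]]]]]]]] := spatial.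
have rP := fP.1.
split.
- apply: (rep_eq_on_tensors hT fP) => x y.
  by rewrite tP (rep1 r1) (rep1 r2) (rep1 rP).
- move=> a b a' b'; apply: (rep_eq_on_tensors hT fP) => x y.
  by rewrite (repM rP) !tP (repM r1) (repM r2).
- move=> a b; apply: (rep_eq_on_tensors hT fP) => x y.
  apply/eqP; rewrite -subr_eq0; apply/eqP.
  apply: (orthogonal_dense_eq0 hT.2) => _ [n [u [v ->]]].
  rewrite inner_sumr big1// => i _; apply/eqP.
  rewrite innerBl subr_eq0 (rep_star rP) starK !tP !hT.1.
  by rewrite (rep_star r1) (rep_star r2) !starK.
Qed.

Lemma tens_unitaryl u : unitary u -> unitary (t u 1).
Proof.
have [t1 tM ts] := tens_algebra => -[u1 u2].
by split; rewrite ts tM star1 mulr1 (u1, u2).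
Qed.

Lemma tens_unitaryr u : unitary u -> unitary (t 1 u).
Proof.
have [t1 tM ts] := tens_algebra => -[u1 u2].
by split; rewrite ts tM star1 mulr1 (u1, u2).
Qed.

(** Factor [t a b] as [t a 1 * t 1 b]. Each slot sends unitaries to unitaries, so it is bounded with
    constant 4. *)
Lemma tens_bounded a b : `|t a b| <= 16 * (`|a| * `|b|).
Proof.
have [t1 tM ts] := tens_algebra.
have -> : t a b = t a 1 * t 1 b by rewrite tM mul1r mulr1.
rewrite (le_trans (cnormM _ _))//.
rewrite [leRHS](_ : _ = (4 * `|a|) * (4 * `|b|)); last by ring.
apply: ler_pM => //.
  apply: (@bounded_on_unitaries R A T (fun x => t x 1)).
    by move=> c x y; rewrite linearPl.
  by move=> u /tens_unitaryl/cnorm_unitary ->.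
apply: (@bounded_on_unitaries R B T (fun x => t 1 x)).
  by move=> c x y; rewrite linearPr.
by move=> u /tens_unitaryr/cnorm_unitary ->.
Qed.

Lemma spatial_state : exists w : T -> C, is_state w.
Proof.
have [_ [H1 [H2 [K [h [_ [_ [P [_ _ _ [rP fP] _]]]]]]]]] := spatial.
(* A nonzero vector exists, since otherwise faithfulness of [P] would give [1 = 0] in [T]; its
   vector state is used. *)
have [x x0] : exists x : K, x != 0.
  apply: contrapT => no; have /eqP := oner_neq0 T; apply.
  apply: fP => x; apply: contrapT => px.
  by apply: no; exists (P 1 x); apply/eqP.
have n0 : inner x x != 0 by rewrite -inner_norm expf_neq0// normr_eq0.
exists (fun a => inner (P a x) x / inner x x); split.
- by move=> c a b; rewrite (rep_linear rP) innerPl mulrDl mulrA.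
- move=> a; apply: divr_ge0; last exact: inner_ge0.
  by rewrite (repM rP) (rep_star rP) starK inner_ge0.
- by rewrite (rep1 rP) divff.
Qed.

End SpatialTensor.

(** * Weyl algebras *)

Section Cis.
Variable R : realType.
Local Notation C := R[i].

Lemma cisD (a b : R) : cis a * cis b = cis (a + b).
Proof.
by apply/eqP; rewrite eq_complex /= cosD sinD addrC [cos a * sin b + _]addrC
  [- _ + _]addrC !eqxx.
Qed.

Lemma cis0 : cis (0 : R) = 1.
Proof. by rewrite /cis cos0 sin0. Qed.

Lemma cispi : cis (pi : R) = -1.
Proof. by rewrite /cis cospi sinpi; apply/eqP; rewrite eq_complex /= oppr0 !eqxx. Qed.

Lemma cisN (a : R) : cis (- a) = Num.conj (cis a).
Proof. by rewrite /cis cosN sinN. Qed.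

Lemma norm_cis (a : R) : `|cis a| = 1.
Proof.
by apply/eqP; rewrite -(@eqrXn2 _ 2)// expr1n normCK -cisN cisD subrr cis0.
Qed.

Lemma pair_addE (a b c d : R) : (a, b) + (c, d) = (a + c, b + d) :> R * R.
Proof. by []. Qed.

End Cis.

Section WeylAlgebra.
Variables (R : realType) (A : cstarAlgType R) (W : R * R -> A).
Hypothesis hW : is_weyl_algebra W.
Local Notation C := R[i].

Lemma weyl0 : W 0 = 1.
Proof.
have e : W 0 * W 0 = W 0.
  by rewrite (weyl_relation hW) /symplectic /= !mul0r subrr mulr0 cis0 scale1r addr0.
by rewrite -[LHS]mul1r -(weyl_unitaryl hW 0) -mulrA e.
Qed.

Lemma weyl_star u : star (W u) = W (- u).
Proof.
rewrite -[LHS]mulr1 -weyl0 -(subrr u).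
have -> : W (u - u) = W u * W (- u).
  rewrite (weyl_relation hW) (_ : symplectic _ _ = 0) ?cis0 ?scale1r//.
  by case: u => a b; rewrite /symplectic /=; ring.
by rewrite mulrA (weyl_unitaryl hW) mul1r.
Qed.

Definition linear_set (M : set A) :=
  forall (c : C) (x y : A), M x -> M y -> M (c *: x + y).

Definition weyl_span (a : A) :=
  forall M : set A, closed M -> linear_set M -> (forall u, M (W u)) -> M a.

Lemma closed_weyl_span : closed weyl_span.
Proof.
move=> a /closureP_norm Ha M cM lM MW; apply: (cM).
apply/closureP_norm => e e0; have [z Mz az] := Ha e e0.
by exists z => //; exact: (Mz M).
Qed.

Lemma linear_weyl_span : linear_set weyl_span.
Proof.
by move=> c x y Mx My M cM lM MW; apply: (lM); [exact: (Mx M)|exact: (My M)].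
Qed.

Lemma weyl_spanW u : weyl_span (W u).
Proof. by move=> M _ _. Qed.

Lemma weyl_spanZ (c : C) x : weyl_span x -> weyl_span (c *: x).
Proof.
(* [linear_set] does not list 0 as a member, so [x] itself serves as the second summand. *)
move=> Mx; have -> : c *: x = (c - 1) *: x + x by rewrite scalerBl scale1r subrK.
exact: linear_weyl_span.
Qed.

(* The closed span is the intersection of all closed subspaces containing the
   generators, so each closure property reduces to checking the generators. *)
Lemma weyl_span_full a : weyl_span a.
Proof.
suff /(weyl_generated hW) -> : is_cstar_subalgebra weyl_span => //.
  by move=> _ [u _ <-]; exact: weyl_spanW.
(* Products are treated in two stages: first a generator on the left, then an arbitrary left factor
   with the right one fixed. *)
have mulW u a' : weyl_span a' -> weyl_span (W u * a').
  apply: (_ : weyl_span `<=` [set x : A | weyl_span (W u * x)]) => x; apply.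
  - apply: (@closed_preimage_bounded _ _ _ (fun x : A => W u * x) `|W u| weyl_span) => //.
    + by move=> x' y'; rewrite mulrBr.
    + by move=> x'; exact: cnormM.
    + exact: closed_weyl_span.
  - move=> c x' y' /= Mx My; rewrite mulrDr -scalerAr.
    exact: linear_weyl_span.
  - move=> v /=; rewrite (weyl_relation hW); apply: weyl_spanZ.
    exact: weyl_spanW.
split.
- exact: linear_weyl_span.
- move=> x y Mx My; move: x Mx.
  apply: (_ : weyl_span `<=` [set x : A | weyl_span (x * y)]) => x; apply.
  - apply: (@closed_preimage_bounded _ _ _ (fun x : A => x * y) `|y| weyl_span) => //.
    + by move=> x' y'; rewrite mulrBl.
    + by move=> x'; rewrite mulrC; exact: cnormM.
    + exact: closed_weyl_span.
  - move=> c x' y' /= Mx My'; rewrite mulrDl -scalerAl.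
    exact: linear_weyl_span.
  - by move=> v /=; exact: mulW.
- apply: (_ : weyl_span `<=` [set x : A | weyl_span (star x)]) => x; apply.
  - apply: (@closed_preimage_bounded _ _ _ star 1 weyl_span) => //.
    + by move=> x' y'; rewrite starB.
    + by move=> x'; rewrite cnorm_star mul1r.
    + exact: closed_weyl_span.
  - move=> c x' y' /= Mx My'; rewrite star_antilinear.
    exact: linear_weyl_span.
  - by move=> v /=; rewrite weyl_star; exact: weyl_spanW.
- exact: closed_weyl_span.
Qed.

Lemma weyl_total (M : set A) : closed M -> linear_set M ->
  (forall u, M (W u)) -> forall a, M a.
Proof. by move=> cM lM MW a; apply: (weyl_span_full a (M := M)). Qed.

End WeylAlgebra.

(** * The state with prescribed values on the tensor square of the Weyl algebra *)

Section Main.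
Variables (R : realType) (A : cstarAlgType R) (W : R * R -> A).
Hypothesis hW : is_weyl_algebra W.
Variables (T : cstarAlgType R) (t : {bilinear A -> A -> T}).
Hypothesis spatial : is_spatial_tensor t.
Local Notation C := R[i].
Local Notation V u v := (t (W u) (W v)).

Lemma weyl_tensM u v u' v' :
  V u v * V u' v' = cis (symplectic u u' + symplectic v v') *: V (u + u') (v + v').
Proof.
have [_ tM _] := tens_algebra spatial.
rewrite tM !(weyl_relation hW) linearZl_LR linearZr_LR scalerA.
by rewrite cisD.
Qed.

Lemma weyl_tens_unitary u v : unitary (V u v).
Proof.
have [t1 tM ts] := tens_algebra spatial.
by split; rewrite ts tM ?(weyl_unitaryl hW) ?(weyl_unitaryr hW).
Qed.

(** The form is antisymmetric, so exchanging the factors doubles the phase. *)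
Lemma weyl_tens_commute u v u' v' :
  V u v * V u' v' =
    cis (2 * (symplectic u u' + symplectic v v')) *: (V u' v' * V u v).
Proof.
rewrite !weyl_tensM scalerA cisD [u' + u]addrC [v' + v]addrC.
by congr (cis _ *: _); rewrite /symplectic; ring.
Qed.

(** The difference of two states is bounded, so its kernel is closed. Vanishing extends from
    generators to each tensor slot in turn, then to sums and their closure. *)
Lemma state_weyl_ext (w w' : T -> C) : is_state w -> is_state w' ->
  (forall u v, w (V u v) = w' (V u v)) -> w = w'.
Proof.
move=> sw sw' ww'; apply/funext.
pose f z := w z - w' z.
have fl c x y : f (c *: x + y) = c * f x + f y.
  by rewrite /f (stateP _ _ _ sw) (stateP _ _ _ sw'); ring.
have fB : {morph f : x y / x - y}.
  by move=> x y; rewrite /f (stateB _ _ sw) (stateB _ _ sw'); ring.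
have fM x : `|f x| <= 8 * `|x|.
  rewrite (le_trans (ler_normB _ _))//.
  by rewrite [leRHS](_ : _ = 4 * `|x| + 4 * `|x|) ?lerD ?state_bounded//; ring.
have f0 : f 0 = 0 by rewrite -(subrr 0) fB subrr.
have ft b : (forall v, f (t b (W v)) = 0) -> forall c, f (t b c) = 0.
  move=> fb c; apply: (weyl_total hW (M := [set x : A | f (t b x) = 0])) => //.
  - apply: (@closed_ker_bounded _ _ C^o (fun x : A => f (t b x)) (8 * (16 * `|b|))).
    + by rewrite !mulr_ge0.
    + by move=> x y; rewrite linearBr fB.
    + move=> x; apply: (le_trans (fM _)); rewrite -!mulrA ler_wpM2l//.
      exact: tens_bounded.
  - by move=> d x y /= fx fy; rewrite linearPr fl fx fy mulr0 addr0.
have ft' v b : f (t b (W v)) = 0.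
  apply: (weyl_total hW (M := [set x : A | f (t x (W v)) = 0])).
  - apply: (@closed_ker_bounded _ _ C^o (fun x : A => f (t x (W v))) (8 * (16 * `|W v|))).
    + by rewrite !mulr_ge0.
    + by move=> x y; rewrite linearBl fB.
    + move=> x; apply: (le_trans (fM _)); rewrite -!mulrA ler_wpM2l//.
      by rewrite [`|W v| * _]mulrC; exact: tens_bounded.
  - by move=> d x y /= fx fy; rewrite linearPl fl fx fy mulr0 addr0.
  - by move=> u /=; rewrite /f ww' subrr.
move=> z; apply/eqP; rewrite -subr_eq0; apply/eqP.
apply: (tensor_total (D := [set x : T | f x = 0]) spatial.1) => //.
- by apply: (@closed_ker_bounded _ _ C^o f 8).
- by move=> x y /= fx fy; rewrite -[x]scale1r fl fx fy mulr0 addr0.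
- by move=> x y /=; apply: ft.
Qed.

(** Multiplicativity at [e] on both sides gives [w x * w e = - (w e * w x)], and [w e] is
    nonzero. *)
Lemma state_anticommute (w : T -> C) (x e : T) : is_state w -> unitary e ->
  `|w e| = 1 -> x * e = - (e * x) -> w x = 0.
Proof.
move=> sw ue we xe.
have := state_eigen sw ue we x; rewrite xe stateN// state_eigenl//.
have we0 : w e != 0 by rewrite -normr_gt0 we ltr01.
rewrite mulrC => /eqP; rewrite eq_sym -subr_eq0 opprK -mulr2n.
by rewrite mulrn_eq0 /= mulf_eq0 (negbTE we0) orbF => /eqP.
Qed.

Variables lambda mu : R.

Definition epr_state (w : T -> C) :=
  [/\ is_state w,
      forall a : R, w (V (a, 0) (- a, 0)) = cis (a * lambda) &
      forall b : R, w (V (0, b) (0, b)) = cis (b * mu)].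

Lemma epr_state_values w u v : epr_state w ->
  w (V u v) = if (u.1 == - v.1) && (u.2 == v.2)
              then cis (u.1 * lambda + u.2 * mu) else 0.
Proof.
case: u v => [u1 u2] [v1 v2] [sw wl wm] /=.
have [->|n1] /= := eqVneq u1 (- v1); last first.
  (* The commutation phase with [V (0, b) (0, b)] is [b * (u1 + v1)], here made equal to [pi]. *)
  pose b := pi / (u1 + v1).
  apply: (@state_anticommute w _ (V (0, b) (0, b))) => //.
  - exact: weyl_tens_unitary.
  - by rewrite wm norm_cis.
  - rewrite weyl_tens_commute -[RHS]scaleN1r -cispi; congr (cis _ *: _).
    rewrite /symplectic /= !mulr0 !subr0 /b.
    have n : u1 + v1 != 0 by rewrite -[v1]opprK subr_eq0.
    by field.
have [->|n2] := eqVneq u2 v2; last first.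
  (* Likewise the phase with [V (a, 0) (- a, 0)] is [a * (v2 - u2)]. *)
  pose a := pi / (v2 - u2).
  apply: (@state_anticommute w _ (V (a, 0) (- a, 0))) => //.
  - exact: weyl_tens_unitary.
  - by rewrite wl norm_cis.
  - rewrite weyl_tens_commute -[RHS]scaleN1r -cispi; congr (cis _ *: _).
    rewrite /symplectic /= !mulr0 !sub0r /a.
    have n : v2 - u2 != 0 by rewrite subr_eq0 eq_sym.
    by field.
(* A member of the group splits into two prescribed unitaries, as the two symplectic phases cancel;
   [w] is multiplicative on this product. *)
have -> : V (- v1, v2) (v1, v2) =
    V (- v1, 0) (- - v1, 0) * V (0, v2) (0, v2).
  rewrite weyl_tensM (_ : symplectic _ _ + _ = 0).
    by rewrite cis0 scale1r !pair_addE opprK !addr0 !add0r.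
  by rewrite /symplectic /=; ring.
rewrite state_eigen// ?wl ?wm ?norm_cis// ?cisD//.
exact: weyl_tens_unitary.
Qed.

Lemma epr_state_unique w w' : epr_state w -> epr_state w' -> w = w'.
Proof.
move=> ew ew'; apply: state_weyl_ext; [by case: ew|by case: ew'|].
by move=> u v; rewrite !epr_state_values.
Qed.

Lemma epr_state_exists : exists w, epr_state w.
Proof.
have [w0 sw0] := spatial_state spatial.
have [t1 tM ts] := tens_algebra spatial.
(* The twist makes 1 the required value at every [l]; opposite phases in the two slots make [X] a
   homomorphism. *)
pose X (l : R * R) : T :=
  cis (- (l.1 * lambda + l.2 * mu)) *: V (l.1, l.2) (- l.1, l.2).
have X0 : X 0 = 1.
  rewrite /X /= !mul0r addr0 oppr0 cis0 scale1r.
  by rewrite -[(0, 0)]/(0 : R * R) weyl0.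
have XD a b : X a * X b = X (a + b).
  rewrite /X -scalerAl -scalerAr weyl_tensM !scalerA !cisD.
  case: a b => [a1 a2] [b1 b2] /=; rewrite !pair_addE (opprD a1 b1).
  by congr (cis _ *: _); rewrite /symplectic /=; ring.
have Xs a : star (X a) = X (- a).
  rewrite /X starZ ts !weyl_star// -cisN.
  by case: a => [a1 a2] /=; congr (cis _ *: V _ _); ring.
have [|tau stau tauX] := delta_state X0 sw0 (V := X).
  move=> [l1 l2] l0.
  (* The form is nondegenerate, so some [(p, q)] pairs with [(l1, l2)] to [pi]; conjugation by
     [V (p, q) 0] then flips the sign of [X (l1, l2)]. *)
  have [p [q pq]] : exists p q, l1 * q - l2 * p = pi.
    have [l10|l10] := eqVneq l1 0; last first.
      by exists 0, (pi / l1); field.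
    have l20 : l2 != 0.
      by apply: contra l0 => /eqP ->; rewrite l10.
    by exists (- pi / l2), 0; field.
  have conj l' : star (V (p, q) 0) * X l' * V (p, q) 0 =
      cis (l'.1 * q - l'.2 * p) *: X l'.
    have [u1 u2] := weyl_tens_unitary (p, q) 0.
    rewrite -mulrA /X -scalerAl weyl_tens_commute -!scalerAr mulrA u1 mul1r.
    rewrite !scalerA mulrC; congr (cis _ * _ *: _).
    by rewrite /symplectic /=; field.
  exists (V (p, q) 0); first exact: weyl_tens_unitary.
  split; first by rewrite conj /= pq cispi scaleN1r.
  by move=> l'; exists (cis (l'.1 * q - l'.2 * p)).
have [w sw wX] := translation_invariant_state X0 XD Xs stau tauX.
have wV a b : w (V (a, b) (- a, b)) = cis (a * lambda + b * mu).
  have := wX (a, b); rewrite /X /= stateZ// => e.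
  by rewrite -[LHS]mul1r -cis0 -(subrr (a * lambda + b * mu)) -cisD -mulrA e mulr1.
exists w; split => //.
- by move=> a; rewrite wV mul0r addr0.
(* The 0 in the second slot is read as [- 0] to match the pattern of [wV]. *)
- by move=> b; rewrite -[X in t _ (W (X, _))]oppr0 wV mul0r add0r.
Qed.

(** The vector [u - w u *: 1] is null for [w]. Its square has nonnegative values under [w1] and
    [w2], and [s] is positive, so it is null for [w1] too. *)
Lemma convex_state_unitary (w w1 w2 : T -> C) (s : R) u : is_state w ->
  is_state w1 -> is_state w2 -> 0 < s -> s < 1 ->
  (forall x, w x = s%:C * w1 x + (1 - s)%:C * w2 x) ->
  unitary u -> `|w u| = 1 -> w1 u = w u.
Proof.
move=> sw sw1 sw2 s0 s1 ww uu wu.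
set y := u - w u *: 1.
have := ww (star y * y); rewrite state_eigen_null// => /esym/eqP.
rewrite paddr_eq0; last 2 first.
- by rewrite mulr_ge0 ?state_positive// ler0c ltW.
- by rewrite mulr_ge0 ?state_positive// ler0c subr_ge0 ltW.
move=> /andP[]; rewrite mulf_eq0 => /orP[|/eqP w1y _].
  by rewrite eq_complex /= gt_eqF.
have := state_null 1 sw1 w1y; rewrite mul1r /y stateB// stateZ//.
rewrite state_normalized// mulr1 => /eqP.
by rewrite subr_eq0 => /eqP.
Qed.

Lemma epr_state_pure w : epr_state w -> is_pure_state w.
Proof.
move=> ew; have [sw wl wm] := ew; split => // w1 w2 s sw1 sw2 /andP[s0 s1] ww.
(* Stated for a general weight, so that it applies to both components after exchanging [s] and
   [1 - s]. *)
have component v v' r : is_state v -> is_state v' -> 0 < r -> r < 1 ->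
    (forall x, w x = r%:C * v x + (1 - r)%:C * v' x) -> v = w.
  move=> sv sv' r0 r1 wv; apply: epr_state_unique => //; split => // a.
    rewrite (convex_state_unitary sw sv sv' r0 r1 wv) ?wl ?norm_cis//.
    exact: weyl_tens_unitary.
  rewrite (convex_state_unitary sw sv sv' r0 r1 wv) ?wm ?norm_cis//.
  exact: weyl_tens_unitary.
split; first exact: (component w1 w2 s).
apply: (component w2 w1 (1 - s)) => //.
- by rewrite subr_gt0.
- by rewrite gtrBl.
- by move=> x; rewrite subKr addrC.
Qed.

End Main.

Theorem theorem1 (R : realType)
    (A : cstarAlgType R) (W : R * R -> A) (hW : is_weyl_algebra W)
    (T : cstarAlgType R) (tens : {bilinear A -> A -> T})
    (htens : is_spatial_tensor tens) (lambda mu : R) :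
  exists w : T -> R[i],
    unique (fun w' : T -> R[i] =>
      [/\ is_state w',
          forall a : R, w' (tens (W (a, 0)) (W (- a, 0))) = cis (a * lambda) &
          forall b : R, w' (tens (W (0, b)) (W (0, b))) = cis (b * mu)]) w
    /\ is_pure_state w.
Proof.
have [w ew] := epr_state_exists hW htens lambda mu.
exists w; split; last exact: (epr_state_pure hW htens ew).
by split => // w' ew'; exact: (epr_state_unique hW htens ew ew').
Qed.
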